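(* The following upper bounds hold: (1) $n(a,b,g)\leq n(a,g)\cdot \tilde n\big(b\cdot n(a,g),\lceil g/2\rceil\big)$ for $a\geq 2$, $g\geq 3$; (2) $n(a,b,g)\leq n(b,g/2)\cdot \tilde n\big(a\cdot n(b,g/2),g\big)$ for $b\geq 2$, $g\geq 6$, $g$ even; (3) $n(a,b,g)\leq 2\cdot n(a,g)$ for $a\geq 2$, $b=1$, $g\leq 6$; (4) $n(a,b,g)\leq 2\cdot \tilde n(b,3)$ for $a=1$, $b\geq 1$, $g=6$.
   Context: All parameters are nonnegative integers. A weighted graph (wgraph) is a pair $G=(L,H)$ of simple finite graphs with $V(L)=V(H)$ and $E(L)\cap E(H)=\varnothing$; edges of $L$ are light (weight 1) and edges of $H$ are heavy (weight 2). A wcycle is a cycle (of length at least 3) in the graph with edge set $E(L)\cup E(H)$; its weight is the sum of the weights of its edges. The girth of $G$ is the minimum weight of a wcycle. $G$ is $(a,b)$-regular if $L$ is $a$-regular and $H$ is $b$-regular. An $(a,b,g)$-wgraph is an $(a,b)$-regular wgraph of girth $g$; $n(a,b,g)$ is the minimum order of an $(a,b,g)$-wgraph ($\infty$ if none exists). $n(r,g)$ is the minimum order of an $r$-regular (ordinary) graph of girth $g$ ($\infty$ if none exists). $\tilde n(r,g)=n(r,g)$ if $r\geq 2$ and $g\geq 3$, and $\tilde n(r,g)=r+1$ if $0\leq r\leq 1$ or $g=2$. *)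

(* Defs.v *)
From mathcomp Require Import all_boot.
From mathcomp Require Import boolp.

Set Implicit Arguments.
Unset Strict Implicit.
Unset Printing Implicit Defensive.

Inductive enat : Type := Fin of nat | Infty.

Declare Scope enat_scope.
Delimit Scope enat_scope with en.
Bind Scope enat_scope with enat.

Definition ele (m n : enat) : bool :=
  match m, n with
  | _, Infty => true
  | Infty, Fin _ => false
  | Fin p, Fin q => p <= q
  end.

(* Infty absorbs everything, including Fin 0. *)
Definition emul (m n : enat) : enat :=
  match m, n with
  | Fin p, Fin q => Fin (p * q)
  | _, _ => Infty
  end.

Notation "m <= n" := (ele m n) : enat_scope.
Notation "m * n" := (emul m n) : enat_scope.

(* The minimum of a set of natural numbers, Infty for the empty set. *)
Definition emin (P : nat -> Prop) : enat :=
  match pselect (exists n, `[< P n >]) with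
  | left exP => Fin (ex_minn exP)
  | right _ => Infty
  end.

Lemma emin_FinP (P : nat -> Prop) (n : nat) :
  emin P = Fin n <-> P n /\ (forall m, P m -> n <= m).
Proof.
rewrite /emin; case: pselect => [exP|noP]; last first.
  by split=> // -[Pn _]; case: noP; exists n; apply: asboolT.
case: ex_minnP => k /asboolW Pk kmin; split=> [[<-]|[Pn nmin]].
  by split=> // m Pm; apply: kmin; apply: asboolT.
have kn : k <= n by apply: kmin; apply: asboolT.
by congr Fin; apply/eqP; rewrite eqn_leq kn nmin.
Qed.

Lemma emin_InftyP (P : nat -> Prop) : emin P = Infty <-> forall n, ~ P n.
Proof.
rewrite /emin; case: pselect => [exP|noP]; split=> //.
  by case: ex_minnP => k /asboolW Pk _ /(_ k Pk).
by move=> _ n Pn; apply: noP; exists n; apply: asboolT.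
Qed.

Record sgraph (V : finType) := SGraph {
  adj :> rel V;
  adj_sym : symmetric adj;
  adj_irr : irreflexive adj
}.

Definition regular (V : finType) (r : nat) (G : sgraph V) : Prop :=
  forall x : V, #|[set y | G x y]| = r.

(* A cycle is the sequence of its vertices in cyclic order, without
   repetition; its last vertex is adjacent to its first one. *)
Definition is_cycle (V : finType) (e : rel V) (c : seq V) : Prop :=
  ucycle e c /\ 2 < size c.

Definition girth (V : finType) (G : sgraph V) : enat :=
  emin (fun l => exists c : seq V, is_cycle G c /\ size c = l).

Record wgraph (V : finType) := WGraph {
  light : sgraph V;
  heavy : sgraph V;
  light_heavy_disj : forall x y, ~~ (light x y && heavy x y)
}.

Definition wadj (V : finType) (G : wgraph V) : rel V :=
  [rel x y | light G x y || heavy G x y].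

Definition eweight (V : finType) (G : wgraph V) (x y : V) : nat :=
  if heavy G x y then 2 else 1.

(* The edges of c are the pairs {x, next c x} for x in c. *)
Definition cweight (V : finType) (G : wgraph V) (c : seq V) : nat :=
  \sum_(x <- c) eweight G x (next c x).

Definition wgirth (V : finType) (G : wgraph V) : enat :=
  emin (fun w => exists c : seq V, is_cycle (wadj G) c /\ cweight G c = w).

Definition abg_wgraph (a b g : nat) (V : finType) (G : wgraph V) : Prop :=
  [/\ regular a (light G), regular b (heavy G) & wgirth G = Fin g].

(* n(a, b, g) *)
Definition wcage_order (a b g : nat) : enat :=
  emin (fun n => exists (V : finType) (G : wgraph V),
                   abg_wgraph a b g G /\ #|V| = n).

(* n(r, g) *)
Definition cage_order (r g : nat) : enat :=
  emin (fun n => exists (V : finType) (G : sgraph V),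
                   [/\ regular r G, girth G = Fin g & #|V| = n]).

(* ~n(r, g).  The last branch (r >= 2 and g <= 1, where ~n is not defined) and
   the value at r = Infty are conventions.  The degree lives in enat so that it
   can be a multiple of some n(r', g'). *)
Definition tcage_order (r : enat) (g : nat) : enat :=
  match r with
  | Fin d =>
      if (2 <= d) && (3 <= g) then cage_order d g
      else if (d <= 1) || (g == 2) then Fin d.+1
      else Infty
  | Infty => Infty
  end.

(* Main.v *)
(* Let G' be a cage for the regularity inside a copy and O a graph, of girth at
   least the required one, whose degree is the number of remaining edge ends in
   a copy of G'. Replace every vertex of O by a copy of G' and distribute the
   edges of O at that vertex evenly over the points of the copy. A cycle of the
   result lies in one copy, or its edges between copies project onto a closed
   trail of O, which contains a cycle of O. In (3) and (4) two copies are joined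
   by a perfect matching instead: a cycle using the matching uses at least two
   of its edges, never two consecutive ones, so its weight is at least 6. *)
Require Import Defs.
From mathcomp Require Import all_boot.

Set Implicit Arguments.
Unset Strict Implicit.
Unset Printing Implicit Defensive.

Lemma ele_Infty (m : enat) : (m <= Infty)%en.
Proof. by case: m. Qed.

Lemma emin_le (P : nat -> Prop) (n : nat) : P n -> (emin P <= Fin n)%en.
Proof.
move=> Pn; case E: (emin P) => [m|]; first by case/emin_FinP: E => _; apply.
by move: Pn; have /emin_InftyP/(_ n) := E.
Qed.

(** * Cycles as sequences *)

Section Cycles.
Variable T : eqType.
Implicit Types (e : rel T) (c : seq T).

(** A cycle of length at least 3 never turns back along the edge just used; this rules out reversed
    steps in projections and consecutive matching edges. *)
Lemma next_next_neq c x :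
  uniq c -> 2 < size c -> x \in c -> next c (next c x) != x.
Proof.
move=> Uc sc /rot_to[i s def_c].
rewrite -!(next_rot i Uc) def_c.
move: Uc sc; rewrite -(rot_uniq i) -(size_rot i) def_c.
case: s {def_c} => [|y [|z s]] //= /andP[]; rewrite !inE !negb_or eqxx.
case/and3P=> nxy nxz _ _ _.
by rewrite !eqxx [y == x]eq_sym (negPf nxy) ?eqxx eq_sym.
Qed.

(** Rotating [c] to start at [y] turns this into induction along a path. *)
Lemma next_invariant (P : pred T) c y :
  uniq c -> y \in c -> P y -> {in c, forall x, P x -> P (next c x)} -> all P c.
Proof.
move=> Uc /rot_to[i s def_c] Py Pnext.
have: cycle (fun x z => P x ==> P z) c.
  by apply: cycle_from_next => // x cx; apply/implyP/Pnext.
rewrite -(rot_cycle i) -(eq_all_r (mem_rot i c)) def_c /= rcons_path.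
case/andP=> + _.
rewrite Py /=; elim: s {def_c} y Py => //= z s IHs y Py /andP[].
by rewrite Py /= => Pz /(IHs z Pz) ->; rewrite Pz.
Qed.

Lemma uniq_map_split (U : eqType) (f : T -> U) c :
  ~~ uniq (map f c) ->
  exists s1 d s2 d' s3, c = s1 ++ d :: s2 ++ d' :: s3 /\ f d = f d'.
Proof.
elim: c => //= a c IHc; rewrite negb_and negbK => /orP[/mapP[d' cd' E]|/IHc].
  by case/splitPr: cd' => p1 p2; exists [::], a, p1, d', p2.
by case=> s1 [d [s2 [d' [s3 [-> E]]]]]; exists (a :: s1), d, s2, d', s3.
Qed.

End Cycles.

Lemma sub_is_cycle (V : finType) (e e' : rel V) c :
  subrel e e' -> is_cycle e c -> is_cycle e' c.
Proof.
move=> ee' [/andP[cc Uc] sc]; split=> //.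
by rewrite /ucycle (sub_cycle ee' cc).
Qed.

(* A walk is the sequence of the ordered pairs of end points of its steps. *)
Definition chain (W : eqType) : rel (W * W) := [rel d d' | d.2 == d'.1].

Lemma path_chain_filter (W : eqType) (d : W * W) ds :
  path (@chain W) d ds ->
  path (@chain W) d [seq d' <- ds | d'.1 != d'.2].
Proof.
elim: ds d => //= d' ds IHds d /andP[dd' pds].
case: eqP => [Ed'|_] /=; last by rewrite dd' IHds.
apply: IHds; case: ds pds => //= d'' ds /andP[d'd'' ->]; rewrite andbT.
by rewrite /chain /= (eqP dd') Ed'.
Qed.

(** * Cycles inside closed trails *)

Section ClosedTrail.
Variables (W : finType) (O : sgraph W).

(* Excluding reversed steps is enough: while a vertex is repeated, the part of
   the walk between its two visits is a shorter closed walk. *)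
Lemma closed_trail_cycle (ds : seq (W * W)) :
  ds != [::] -> cycle (@chain W) ds ->
  {in ds, forall d, O d.1 d.2} ->
  {in ds, forall d, (d.2, d.1) \notin ds} ->
  exists2 c, is_cycle O c & size c <= size ds.
Proof.
have [n] := ubnP (size ds); elim: n ds => // n IHn ds; rewrite ltnS.
move=> le_ds_n ds_n0 cds Ods rds.
have [Uds|] := boolP (uniq (map fst ds)); last first.
  case/uniq_map_split=> [s1 [d [s2 [d' [s3 [E Ed]]]]]].
  have sub : {subset d :: s2 <= ds}.
    move=> x; rewrite E mem_cat -cat_cons mem_cat => ->.
    by rewrite orbT.
  have lt_size : size (d :: s2) < size ds.
    by rewrite E size_cat /= size_cat /= !addnS !ltnS addnCA leq_addr.
  have [|||||c cc le_c] := IHn (d :: s2).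
  - exact: leq_trans lt_size le_ds_n.
  - by [].
  - move: cds; rewrite E cycle_catC /= -catA rcons_path cat_path /=.
    case/andP=> /and3P[pds2 cd' _] _.
    by rewrite rcons_path pds2 /= /chain /= Ed.
  - by move=> x /sub/Ods.
  - by move=> x xs; apply: contra (rds x (sub _ xs)) => /sub.
  by exists c; last exact: leq_trans le_c (ltnW lt_size).
exists (map fst ds); last by rewrite size_map.
split; last first.
  (* A closed walk of one step is a loop, and one of two steps reverses its first step. *)
  case: ds ds_n0 cds Ods rds {le_ds_n Uds} => [|d [|d' [|? ?]]] //= _.
    rewrite /chain /= andbT => /eqP E /(_ d (mem_head _ _)).
    by rewrite E adj_irr.
  rewrite /chain /= andbT => /andP[/eqP E /eqP E'] _ /(_ d (mem_head _ _)).
  by rewrite E -E' -surjective_pairing !inE eqxx orbT.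
rewrite /ucycle Uds andbT cycle_map.
apply: (@sub_in_cycle _ (mem ds) (@chain W)) cds; last exact/allP.
by move=> d d' dd _; rewrite /chain /= => /eqP <-; apply: Ods.
Qed.

End ClosedTrail.

Lemma pair_inj (S T : Type) (x : S) : injective (@pair S T x).
Proof. by move=> y z []. Qed.

(** * Disjoint copies of a graph *)

Section Copies.
Variables (W V : finType) (I : sgraph V).
Implicit Types p q : W * V.

Definition copies_adj : rel (W * V) := [rel p q | (p.1 == q.1) && I p.2 q.2].

Lemma copies_sym : symmetric copies_adj.
Proof. by move=> p q; rewrite /copies_adj /= eq_sym adj_sym. Qed.

Lemma copies_irr : irreflexive copies_adj.
Proof. by move=> p; rewrite /copies_adj /= adj_irr andbF. Qed.

Definition copies : sgraph (W * V)%type := SGraph copies_sym copies_irr.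

Lemma copies_regular r : regular r I -> regular r copies.
Proof.
move=> rI [w x]; rewrite -(rI x) -[RHS](card_imset _ (@pair_inj _ _ w)).
apply: eq_card => -[w' x']; rewrite inE /= /copies_adj /=.
apply/andP/imsetP => [[/eqP-> Ixx']|[y]]; first by exists x'; rewrite ?inE.
by rewrite inE => ? [-> ->]; rewrite eqxx.
Qed.

Lemma is_cycle_copies w c : is_cycle I c -> is_cycle copies (map (pair w) c).
Proof.
case=> /andP[cc Uc] sc; split; last by rewrite size_map.
rewrite /ucycle map_inj_uniq ?Uc ?andbT; last exact: pair_inj.
rewrite cycle_map; apply: sub_cycle cc => x y /=.
by rewrite /copies_adj /= eqxx.
Qed.

(** The first coordinate is constant along the cycle, so the second projection is injective on
    it. *)
Lemma is_cycle_copiesW c : is_cycle copies c -> is_cycle I (map snd c).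
Proof.
case=> /andP[cc Uc] sc; split; last by rewrite size_map.
case: c sc cc Uc => // p0 c _; set c' := p0 :: c => cc Uc.
have /allP fst_c : all (fun p => p.1 == p0.1) c'.
  apply: (@next_invariant _ _ _ p0); rewrite ?mem_head //.
  by move=> p /(next_cycle cc) /andP[/eqP <-].
apply/andP; split.
  by rewrite cycle_map; apply: sub_cycle cc => x y /andP[].
rewrite map_inj_in_uniq // => -[w x] [w' x'].
move=> /fst_c /= /eqP -> /fst_c /= /eqP ->.
by move->.
Qed.

End Copies.
Arguments copies W {V} I.

(** * Spreading the edges of a graph over copies *)

Section Spread.
Variables (W V : finType) (O : sgraph W) (x0 : V) (k : nat).
Implicit Types p q : W * V.

(* [port w w'] is the point of the copy of V at w where the edge ww' is
   attached; the neighbours of w are listed against k repetitions of V. *)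
Definition port (w w' : W) : V :=
  nth x0 (flatten (nseq k (enum V))) (index w' (enum [set y | O w y])).

(** [port w] maps the list of neighbours of [w] exactly onto [k] concatenated enumerations of [V],
    each containing [x] once. *)
Lemma card_port w x : #|[set y | O w y]| = k * #|V| ->
  #|[set w' | O w w' && (port w w' == x)]| = k.
Proof.
move=> cardN; set s := flatten (nseq k (enum V)).
set N := enum [set y | O w y].
have sizeN : size N = size s.
  rewrite /N -cardE cardN /s size_flatten /shape map_nseq sumn_nseq -cardE.
  exact: mulnC.
have map_port : map (port w) N = s.
  apply: (@eq_from_nth _ x0); rewrite ?size_map // => i lt_i.
  rewrite (nth_map w) // /port index_uniq ?enum_uniq //.
have <- : count_mem x s = k.
  rewrite /s count_flatten map_nseq sumn_nseq.
  by rewrite (count_uniq_mem _ (enum_uniq _)) mem_enum mul1n.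
rewrite -map_port count_map -size_filter cardE.
apply/perm_size/uniq_perm => [||w']; rewrite ?enum_uniq //.
  exact/filter_uniq/enum_uniq.
by rewrite mem_enum mem_filter mem_enum !inE andbC.
Qed.

Definition spread_adj : rel (W * V) :=
  [rel p q | [&& O p.1 q.1, port p.1 q.1 == p.2 & port q.1 p.1 == q.2]].

Lemma spread_sym : symmetric spread_adj.
Proof. by move=> p q; rewrite /spread_adj /= adj_sym [X in _ && X]andbC. Qed.

Lemma spread_irr : irreflexive spread_adj.
Proof. by move=> p; rewrite /spread_adj /= adj_irr. Qed.

Definition spread : sgraph (W * V)%type := SGraph spread_sym spread_irr.

Lemma spread_regular : regular (k * #|V|) O -> regular k spread.
Proof.
move=> rO [w x]; rewrite -(card_port x (rO w)).
have inj : injective (fun w' => (w', port w' w)) by move=> ? ? [].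
rewrite -[RHS](card_imset _ inj); apply: eq_card => -[w' x']; rewrite inE /=.
rewrite /spread_adj /=; apply/and3P/imsetP => [[Oww' fx /eqP <-]|[y]].
  by exists w'; rewrite // inE Oww'.
by rewrite inE => /andP[Owy fx] [-> ->]; rewrite Owy fx eqxx.
Qed.

(* The spread edges of a cycle project onto distinct edges of O, which form a
   closed trail. *)
Lemma spread_cycle (I : sgraph V) m c :
  (forall c', is_cycle O c' -> m <= size c') ->
  is_cycle [rel p q | copies W I p q || spread p q] c ->
  is_cycle (copies W I) c \/ m <= count (fun p => spread p (next c p)) c.
Proof.
move=> girthO [/andP[cc Uc] sc].
have [/hasP[p0 cp0 Sp0]|/hasPn noS] :=
  boolP (has (fun p => spread p (next c p)) c); last first.
  left; split=> //; rewrite /ucycle Uc andbT; apply: cycle_from_next => // p cp.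
  by have /= := next_cycle cc cp; case/orP=> // Sp; case/negP: (noS p cp).
right; pose dart p := (p.1, (next c p).1).
pose loopless (d : W * W) := d.1 != d.2.
(* Copy edges project onto loops; spread edges do not, since [O] is irreflexive. *)
have dartE p : p \in c -> loopless (dart p) = spread p (next c p).
  move=> cp; apply/idP/idP; rewrite /loopless /=.
    have /= /orP[/andP[/eqP ->]|//] := next_cycle cc cp.
    by rewrite eqxx.
  by case/and3P=> + _ _; apply: contraTneq => ->; rewrite adj_irr.
have [i s def_c] := rot_to cp0.
have in_c p : (p \in p0 :: s) = (p \in c) by rewrite -def_c mem_rot.
pose ds := filter loopless (map dart (p0 :: s)).
have dsP d : d \in ds ->
    exists p, [/\ p \in c, d = dart p & spread p (next c p)].
  rewrite mem_filter => /andP[ld /mapP[p]]; rewrite in_c => cp Ed.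
  by exists p; split=> //; rewrite -dartE // -Ed.
have size_ds : size ds = count (fun p => spread p (next c p)) c.
  rewrite /ds size_filter count_map.
  have /permP <- : perm_eq (p0 :: s) c by rewrite -def_c perm_rot.
  by apply: eq_in_count => p; rewrite in_c => /dartE.
have lp0 : loopless (dart p0) by rewrite dartE.
have ds_cons : ds = dart p0 :: filter loopless (map dart s).
  by rewrite /ds /= lp0.
rewrite -size_ds.
have [||||c' cc' le_c'] := @closed_trail_cycle _ O ds.
- by rewrite ds_cons.
(* The rotation starts at a spread edge, so the first dart survives the filter and the filtered walk
   still closes up. *)
- have : cycle (@chain W) (map dart (rot i c)).
    rewrite map_rot rot_cycle cycle_map; apply: cycle_from_next => // p cp.
    by rewrite /chain /=.
  rewrite def_c ds_cons /= => /path_chain_filter.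
  by rewrite filter_rcons; have -> : (dart p0).1 != (dart p0).2 by [].
- by move=> d /dsP[p [_ -> /and3P[]]].
(* An edge of [O] determines both ends of its lift through [port]. A reversed dart at [q] thus
   forces [q = next c p] and [next c q = p]. *)
- move=> d /dsP[p [cp -> /and3P[_ /eqP f1 /eqP f2]]].
  apply/negP=> /dsP[q [cq [E1 E2] /and3P[_ /eqP g1 /eqP g2]]].
  have Eq : q = next c p.
    by rewrite [LHS]surjective_pairing -g1 -E1 -E2 f2 -surjective_pairing.
  have := next_next_neq Uc sc cp; rewrite -Eq.
  rewrite [next c q]surjective_pairing -g2 -E1 -E2 f1.
  by rewrite -surjective_pairing eqxx.
exact: leq_trans (girthO _ cc') le_c'.
Qed.

Lemma copies_spread_disj (I : sgraph V) p q :
  ~~ (copies W I p q && spread p q).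
Proof.
apply/negP=> /andP[/andP[/eqP E _] /and3P[+ _ _]].
by rewrite E adj_irr.
Qed.

End Spread.

(** * Two copies joined by a perfect matching *)

Section Prism.
Variable V : finType.
Implicit Types p q : bool * V.

Definition rungs_adj : rel (bool * V) :=
  [rel p q | (q.1 == ~~ p.1) && (p.2 == q.2)].

Lemma rungs_sym : symmetric rungs_adj.
Proof.
move=> [i x] [j y]; rewrite /rungs_adj /= [y == x]eq_sym.
by case: i j => [] [].
Qed.

Lemma rungs_irr : irreflexive rungs_adj.
Proof. by move=> [[] x]. Qed.

Definition rungs : sgraph (bool * V)%type := SGraph rungs_sym rungs_irr.

Lemma rungs_regular : regular 1 rungs.
Proof.
move=> [i x]; rewrite -[RHS](cards1 (~~ i, x)); congr #|pred_of_set _|.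
apply/setP=> -[j y]; rewrite !inE /= /rungs_adj /= xpair_eqE.
by rewrite [y == x]eq_sym.
Qed.

Lemma copies_rungs_disj (I : sgraph V) p q :
  ~~ (copies bool I p q && rungs p q).
Proof.
apply/negP=> /andP[/andP[/eqP E _] /andP[]]; rewrite E.
by case: (q.1).
Qed.

(** A cycle that leaves one copy must come back, which gives two rungs, one in each direction. Each
    rung is followed by a copy edge, and the two copy edges start in different copies. *)
Lemma prism_cycle (I : sgraph V) c :
  is_cycle [rel p q | copies bool I p q || rungs p q] c ->
  is_cycle (copies bool I) c \/
  [/\ 4 <= size c, 2 <= count (fun p => rungs p (next c p)) c
    & 2 <= count (fun p => copies bool I p (next c p)) c].
Proof.
move=> [/andP[cc Uc] sc].
have [/hasP[p cp Rp]|/hasPn noR] :=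
  boolP (has (fun p => rungs p (next c p)) c); last first.
  left; split=> //; rewrite /ucycle Uc andbT; apply: cycle_from_next => // p cp.
  by have /= := next_cycle cc cp; case/orP=> // Rp; case/negP: (noR p cp).
right.
(* If no rung left copy [i], the cycle would stay there once inside; but the rung at [p] has one end
   outside. *)
have crossing i : has (fun p => rungs p (next c p) && (p.1 == i)) c.
  apply: contraT => /hasPn no_i.
  have stay q : q \in c -> q.1 == i -> (next c q).1 == i.
    move=> cq qi; have /= /orP[/andP[/eqP <- //]|Rq] := next_cycle cc cq.
    by case/negP: (no_i q cq); rewrite qi andbT.
  have [pi|pi] := boolP (p.1 == i).
    by case/negP: (no_i p cp); rewrite pi andbT.
  have npi : (next c p).1 == i.
    by case/andP: Rp => /eqP -> _; case: (p.1) i pi {no_i stay} => [] [].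
  have ncp : next c p \in c by rewrite mem_next.
  have all_i := next_invariant (P := fun q => q.1 == i) Uc ncp npi stay.
  by rewrite (allP all_i p cp) in pi.
have [p1 c1 /andP[R1 /eqP f1]] := hasP (crossing true).
have [p2 c2 /andP[R2 /eqP f2]] := hasP (crossing false).
(* Two consecutive rungs would lead back to [q]. *)
have no_rung q : q \in c -> rungs q (next c q) ->
    ~~ rungs (next c q) (next c (next c q)).
  move=> cq Rq; apply: contra (next_next_neq Uc sc cq).
  case/andP: Rq => /eqP E1 /eqP E2 /andP[/eqP E3 /eqP E4].
  by rewrite -pair_eqE /= E3 E1 negbK -E4 -E2 !eqxx.
have copy_next q : q \in c -> rungs q (next c q) ->
    copies bool I (next c q) (next c (next c q)).
  move=> cq /(no_rung q cq) nR; have ncq : next c q \in c by rewrite mem_next.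
  by have /= /orP[|/(negP nR)] := next_cycle cc ncq.
have U12 : uniq [:: p1; p2].
  by rewrite /= inE andbT; apply/eqP=> E; move: f1; rewrite E f2.
have Un12 : uniq [:: next c p1; next c p2].
  rewrite /= inE andbT; apply/eqP=> E.
  have := congr1 fst E.
  case/andP: R1 => /eqP -> _; case/andP: R2 => /eqP -> _.
  by rewrite f1 f2.
have count2 (P : pred (bool * V)) q q' : uniq [:: q; q'] ->
    q \in c -> q' \in c -> P q -> P q' -> 2 <= count P c.
  move=> Uq cq cq' Pq Pq'; rewrite -size_filter; apply: (uniq_leq_size Uq) => r.
  by rewrite !inE => /orP[]/eqP->; rewrite mem_filter ?Pq ?Pq'.
have Rc : 2 <= count (fun p => rungs p (next c p)) c.
  by apply: (count2 _ _ _ U12).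
have Cc : 2 <= count (fun p => copies bool I p (next c p)) c.
  apply: (count2 (fun p => copies bool I p (next c p)) _ _ Un12);
    by rewrite ?mem_next //; apply: copy_next.
split=> //.
rewrite -(count_predC (fun p => rungs p (next c p))).
apply: leq_add Rc (leq_trans Cc _); apply: sub_count => q /= Cq.
by apply/negP=> Rq; case/negP: (copies_rungs_disj I q (next c q)); apply/andP.
Qed.

End Prism.

(** * Weights of cycles and the order of a weighted cage *)

Section Weight.
Variables (V : finType) (G : wgraph V).

(** Every edge counts once and every heavy edge once more, so bounds on the length and on the number
    of heavy edges add up. *)
Lemma cweightE c :
  cweight G c = size c + count (fun x => heavy G x (next c x)) c.
Proof.
rewrite /cweight -sum1_count -sum1_size [X in _ + X]big_mkcond -big_split /=.
by apply: eq_bigr => x _; rewrite /eweight; case: ifP.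
Qed.

Lemma cweight_light c : is_cycle (light G) c -> cweight G c = size c.
Proof.
case=> /andP[cc _] _; rewrite cweightE (eq_in_count (a2 := pred0)).
  by rewrite count_pred0 addn0.
move=> x cx; apply/negP=> Hx; have := light_heavy_disj G x (next c x).
by rewrite Hx (next_cycle cc cx).
Qed.

Lemma cweight_heavy c : is_cycle (heavy G) c -> cweight G c = 2 * size c.
Proof.
case=> /andP[cc _] _; rewrite cweightE (eq_in_count (a2 := predT)).
  by rewrite count_predT mul2n addnn.
by move=> x cx; rewrite (next_cycle cc cx).
Qed.

Lemma is_wcycle_light c : is_cycle (light G) c -> is_cycle (wadj G) c.
Proof. by apply: sub_is_cycle => x y Lxy; apply/orP; left. Qed.

Lemma is_wcycle_heavy c : is_cycle (heavy G) c -> is_cycle (wadj G) c.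
Proof. by apply: sub_is_cycle => x y Hxy; apply/orP; right. Qed.

(** The cycle [c] attains the lower bound, which makes the girth exactly [g]. *)
Lemma wcage_order_le a b g c :
  regular a (light G) -> regular b (heavy G) ->
  is_cycle (wadj G) c -> cweight G c = g ->
  (forall c', is_cycle (wadj G) c' -> g <= cweight G c') ->
  (wcage_order a b g <= Fin #|V|)%en.
Proof.
move=> ra rb cc wc ge_g; apply: emin_le; exists V, G; split=> //; split=> //.
apply/emin_FinP; split; first by exists c.
by move=> _ [c' [cc' <-]]; apply: ge_g.
Qed.

End Weight.

Lemma cage_orderP r g n : cage_order r g = Fin n ->
  exists (V : finType) (G : sgraph V) c,
    [/\ regular r G, #|V| = n, is_cycle G c, size c = g
      & forall c', is_cycle G c' -> g <= size c'].
Proof.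
case/emin_FinP=> -[V [G [rG /emin_FinP[[c [cc sc]] ge_g] cV]]] _.
by exists V, G, c; split=> // c' cc'; apply: ge_g; exists c'.
Qed.

(** * Complete graphs, for the degenerate values of the modified cage order *)

Section Complete.
Variable V : finType.

Definition complete_adj : rel V := [rel x y | x != y].

Lemma complete_sym : symmetric complete_adj.
Proof. by move=> x y; rewrite /complete_adj /= eq_sym. Qed.

Lemma complete_irr : irreflexive complete_adj.
Proof. by move=> x; rewrite /complete_adj /= eqxx. Qed.

Definition complete : sgraph V := SGraph complete_sym complete_irr.

Lemma complete_regular : regular #|V|.-1 complete.
Proof.
move=> x; rewrite -(cardsC1 x); apply: eq_card => y.
by rewrite !inE /= /complete_adj /= eq_sym.
Qed.

End Complete.

(* The girth condition is only a lower bound: in the degenerate cases the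
   witness is a complete graph, which has girth 3 or no cycle at all. *)
Lemma tcage_orderP d g n : tcage_order (Fin d) g = Fin n ->
  exists (W : finType) (O : sgraph W),
    [/\ regular d O, #|W| = n, 0 < n & forall c, is_cycle O c -> g <= size c].
Proof.
rewrite /tcage_order; case: ifP => [_|_].
  case/cage_orderP=> W [O [[|w c] [rO cW [_ sc] _ ge_g]]] //.
  by exists W, O; split=> //; rewrite -cW; apply/card_gt0P; exists w.
case: ifP => // dg [<-]; exists 'I_d.+1, (complete 'I_d.+1).
split=> //; last 1 first.
- move=> c [/andP[_ Uc] sc]; case/orP: dg => [d1|/eqP->]; last exact: ltnW.
  have := max_card (mem c); rewrite (card_uniqP Uc) card_ord.
  by move/(leq_trans sc); rewrite ltnS ltnNge d1.
- by have := @complete_regular 'I_d.+1; rewrite card_ord.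
- by rewrite card_ord.
Qed.

(** * The four upper bounds *)

Lemma wcage_order_light_copies a b g :
  (wcage_order a b g <=
     cage_order a g * tcage_order (Fin b * cage_order a g) (uphalf g))%en.
Proof.
case EN: (cage_order a g) => [N|]; last exact: ele_Infty.
case EM: (tcage_order _ _) => [M|]; last exact: ele_Infty.
have [V [I [c [rI cardV cI sc girthI]]]] := cage_orderP EN.
have [W [O [rO cardW W_gt0 girthO]]] := tcage_orderP EM.
have [w _] : exists w, w \in W by apply/card_gt0P; rewrite cardW.
(* The first vertex [x] of the cycle serves as the default point of [port]. *)
case: c cI sc => [[] //|x c cI sc]; rewrite -cardV in rO.
pose G := WGraph (@copies_spread_disj W V O x b I).
rewrite -[(_ * _)%en]/(Fin (N * M)) mulnC -cardV -cardW -card_prod.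
have cG := is_cycle_copies w cI.
apply: (@wcage_order_le _ G _ _ _ (map (pair w) (x :: c))).
- exact: copies_regular.
- exact: spread_regular.
- exact: is_wcycle_light.
- by rewrite cweight_light // size_map.
move=> c' /(spread_cycle girthO)[cI'|le_c'].
  rewrite cweight_light // -(size_map snd); exact/girthI/is_cycle_copiesW.
rewrite cweightE -[leqLHS]odd_double_half.
have := leq_trans le_c' (count_size _ _).
move: le_c'; rewrite uphalf_half /= => h1 h2.
by rewrite -addnn addnA leq_add // (leq_trans _ h1) ?leq_addl.
Qed.

Lemma wcage_order_heavy_copies a b g : ~~ odd g ->
  (wcage_order a b g <=
     cage_order b g./2 * tcage_order (Fin a * cage_order b g./2) g)%en.
Proof.
move=> g_even.
case EN: (cage_order b _) => [N|]; last exact: ele_Infty.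
case EM: (tcage_order _ _) => [M|]; last exact: ele_Infty.
have [V [I [c [rI cardV cI sc girthI]]]] := cage_orderP EN.
have [W [O [rO cardW W_gt0 girthO]]] := tcage_orderP EM.
have [w _] : exists w, w \in W by apply/card_gt0P; rewrite cardW.
case: c cI sc => [[] //|x c cI sc]; rewrite -cardV in rO.
have disj p q : ~~ (spread O x a p q && copies W I p q).
  by rewrite andbC; apply: copies_spread_disj.
pose G := WGraph disj.
rewrite -[(_ * _)%en]/(Fin (N * M)) mulnC -cardV -cardW -card_prod.
have cG := is_cycle_copies w cI.
have gE : 2 * g./2 = g by rewrite mul2n even_halfK.
apply: (@wcage_order_le _ G _ _ _ (map (pair w) (x :: c))).
- exact: spread_regular.
- exact: copies_regular.
- exact: is_wcycle_heavy.
- by rewrite cweight_heavy // size_map sc.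
move=> c' cc'.
have : is_cycle [rel p q | copies W I p q || spread O x a p q] c'.
  by apply: sub_is_cycle cc' => p q /=; rewrite orbC.
case/(spread_cycle girthO)=> [cI'|le_c'].
  rewrite cweight_heavy // -gE leq_mul2l -(size_map snd).
  exact/girthI/is_cycle_copiesW.
(* At least [g] light spread edges are used, so the length alone reaches [g]. *)
by rewrite cweightE (leq_trans le_c') // (leq_trans (count_size _ _)) ?leq_addr.
Qed.

Lemma wcage_order_light_prism a g : g <= 6 ->
  (wcage_order a 1 g <= Fin 2 * cage_order a g)%en.
Proof.
move=> le_g6.
case EN: (cage_order a g) => [N|]; last exact: ele_Infty.
have [V [I [c [rI cardV cI sc girthI]]]] := cage_orderP EN.
rewrite -[(_ * _)%en]/(Fin (2 * N)).
pose G := WGraph (@copies_rungs_disj V I).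
rewrite -cardV -card_bool -card_prod.
have cG := is_cycle_copies true cI.
apply: (@wcage_order_le _ G _ _ _ (map (pair true) c)).
- exact: copies_regular.
- exact: rungs_regular.
- exact: is_wcycle_light.
- by rewrite cweight_light // size_map.
move=> c' /prism_cycle[cI'|[le4 le2 _]].
  rewrite cweight_light // -(size_map snd); exact/girthI/is_cycle_copiesW.
(* At least four edges, two of them heavy rungs. *)
by rewrite cweightE (leq_trans le_g6) // -[6]/(4 + 2) leq_add.
Qed.

Lemma wcage_order_heavy_prism b : 1 <= b ->
  (wcage_order 1 b 6 <= Fin 2 * tcage_order (Fin b) 3)%en.
Proof.
move=> b_gt0.
case EM: (tcage_order _ _) => [M|]; last exact: ele_Infty.
have [V [I [rI cardV V_gt0 _]]] := tcage_orderP EM.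
rewrite -[(_ * _)%en]/(Fin (2 * M)).
have [u _] : exists u, u \in V by apply/card_gt0P; rewrite cardV.
have [v] : exists v, v \in [set v | I u v] by apply/card_gt0P; rewrite rI.
rewrite inE => Iuv.
have disj p q : ~~ (rungs V p q && copies bool I p q).
  by rewrite andbC; apply: copies_rungs_disj.
pose G := WGraph disj.
have -> : 2 * M = #|{: bool * V}| by rewrite card_prod card_bool cardV.
have nuv : (u == v) = false by apply/eqP=> E; rewrite E adj_irr in Iuv.
have nvu : (v == u) = false by rewrite eq_sym.
have Ivu : I v u by rewrite adj_sym.
(* Two heavy copies of the edge [uv] and two light rungs: weight exactly 6. *)
pose c := [:: (true, u); (true, v); (false, v); (false, u)].
apply: (@wcage_order_le _ G _ _ _ c).
- exact: rungs_regular.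
- exact: copies_regular.
- split=> //; rewrite /ucycle /= !inE !xpair_eqE /rungs_adj /copies_adj /=.
  by rewrite /wadj /= /rungs_adj /copies_adj /= ?(eqxx, nuv, nvu, Iuv, Ivu).
- rewrite cweightE /= !xpair_eqE /= /copies_adj /= ?(eqxx, nuv, nvu) /=.
  by rewrite ?(eqxx, nuv, nvu, Iuv, Ivu).
move=> c' cc'.
have : is_cycle [rel p q | copies bool I p q || rungs V p q] c'.
  by apply: sub_is_cycle cc' => p q /=; rewrite orbC.
case/prism_cycle=> [cI'|[le4 _ le2]].
  (* Inside a copy there are at least three edges, all heavy. *)
  by rewrite cweight_heavy // -[6]/(2 * 3) leq_mul2l; case: cI'.
by rewrite cweightE -[6]/(4 + 2) leq_add.
Qed.

Theorem theorem9 :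
  [/\ forall a b g : nat, (2 <= a)%N -> (3 <= g)%N ->
        (wcage_order a b g <=
           cage_order a g * tcage_order (Fin b * cage_order a g) (uphalf g))%en,
      forall a b g : nat, (2 <= b)%N -> (6 <= g)%N -> ~~ odd g ->
        (wcage_order a b g <=
           cage_order b g./2 * tcage_order (Fin a * cage_order b g./2) g)%en,
      forall a b g : nat, (2 <= a)%N -> b = 1%N -> (g <= 6)%N ->
        (wcage_order a b g <= Fin 2 * cage_order a g)%en
    & forall a b g : nat, a = 1%N -> (1 <= b)%N -> g = 6%N ->
        (wcage_order a b g <= Fin 2 * tcage_order (Fin b) 3)%en ].
Proof.
split.
- by move=> a b g _ _; apply: wcage_order_light_copies.
- by move=> a b g _ _; apply: wcage_order_heavy_copies.
- by move=> a _ g _ -> ; apply: wcage_order_light_prism.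
- by move=> _ b _ -> b_gt0 ->; apply: wcage_order_heavy_prism.
Qed.
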